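(* Let $\mathbb{X}$ be a smooth real Banach space and let $\mathbb{Y}$ be a proper linear subspace of $\mathbb{X}$ with $\dim \mathbb{Y} > 1$. Then $\mathbb{Y}$ is an anti-coproximinal subspace of $\mathbb{X}$ if and only if $\overline{\operatorname{span} \mathcal{J}_{\mathbb{Y}}}^{w^*} = \mathbb{X}^*$.
   Context: All Banach spaces are real; $S_{\mathbb{X}}$ denotes the unit sphere and $\mathbb{X}^*$ the dual of $\mathbb{X}$. For nonzero $x \in \mathbb{X}$, $J(x) = \{f \in S_{\mathbb{X}^*} : f(x) = \|x\|\}$. A nonzero $x$ is smooth if $J(x)$ is a singleton; $Sm(\mathbb{X})$ is the set of all smooth points of $\mathbb{X}$; $\mathbb{X}$ is smooth if every $x \in S_{\mathbb{X}}$ is smooth. For a subspace $\mathbb{Y}$, $\mathcal{J}_{\mathbb{Y}} = \{f \in S_{\mathbb{X}^*} : f(y) = 1 \text{ for some } y \in Sm(\mathbb{X}) \cap S_{\mathbb{Y}}\}$ (empty if $Sm(\mathbb{X}) \cap S_{\mathbb{Y}} = \emptyset$). $\overline{M}^{w^*}$ denotes the weak*-closure of $M \subseteq \mathbb{X}^*$. Given $x \in \mathbb{X}$, an element $y_0 \in \mathbb{Y}$ is a best coapproximation to $x$ out of $\mathbb{Y}$ if $\|y_0 - y\| \le \|x - y\|$ for all $y \in \mathbb{Y}$. $\mathbb{Y}$ is an anti-coproximinal subspace of $\mathbb{X}$ if for every $x \in \mathbb{X} \setminus \mathbb{Y}$ there does not exist any best coapproximation to $x$ out of $\mathbb{Y}$.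 *)

(* Defs.v *)
From HB Require Import structures.
From mathcomp Require Import all_boot all_order all_algebra.
From mathcomp Require Import all_classical all_reals all_analysis.
Import Order.TTheory GRing.Theory Num.Theory.
Import numFieldNormedType.Exports.

Set Implicit Arguments.
Unset Strict Implicit.
Unset Printing Implicit Defensive.

Local Open Scope classical_set_scope.
Local Open Scope ring_scope.

Section LinearAlgebra.
Variables (R : realType) (V : lmodType R).

Definition lin_span (A : set V) : set V :=
  [set v | exists (n : nat) (a : 'I_n -> R) (w : 'I_n -> V),
    (forall i, A (w i)) /\ v = \sum_(i < n) a i *: w i].

Definition lin_independent (n : nat) (w : 'I_n -> V) : Prop :=
  forall a : 'I_n -> R, \sum_(i < n) a i *: w i = 0 -> forall i, a i = 0.

(* [\dim] is only available for finite-dimensional spaces; here [Y] may be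
   infinite-dimensional, and then [dim_gt n Y] holds for every [n]. *)
Definition dim_gt (n : nat) (Y : {pred V}) : Prop :=
  exists w : 'I_n.+1 -> V, (forall i, w i \in Y) /\ lin_independent w.

End LinearAlgebra.

Section Dual.
Variables (R : realType) (X : normedModType R).

Definition dual_pred : {pred X -> R^o} :=
  [pred f : X -> R^o | `[< scalar f /\ continuous f >]].

Fact dual_pred_submod_closed : submod_closed dual_pred.
Proof.
split=> [|a f g /asboolP[lf cf] /asboolP[lg cg]]; apply/asboolP; split.
- by move=> b x y /=; rewrite mulr0 addr0.
- by move=> x; exact: cvg_cst.
- move=> b x y; have E z : (a *: f + g) z = a * f z + g z by [].
  by rewrite !E (lf b x y) (lg b x y) !mulrDr addrACA !mulrA (mulrC a).
- by move=> x; apply: cvgD (cg x); apply: cvgZr; exact: cf.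
Qed.

HB.instance Definition _ :=
  GRing.isSubmodClosed.Build R (X -> R^o) dual_pred dual_pred_submod_closed.

Record dual := Dual { dual_fun :> X -> R^o; _ : dual_fun \in dual_pred }.

HB.instance Definition _ := [isSub for dual_fun].
HB.instance Definition _ := [Choice of dual by <:].
HB.instance Definition _ := [SubChoice_isSubLmodule of dual by <:].

(* The set is nonempty, and bounded because [f] is continuous, so that [sup]
   is a genuine supremum. *)
Definition dual_norm (f : dual) : R :=
  sup [set `|f x| | x in [set x : X | `|x| <= 1]].

(* The coarsest topology making every evaluation [f |-> f x] continuous. *)
Definition weak_star : Type :=
  initial_topology (fun f : dual => (f : X -> R^o) : {ptws X -> R^o}).

HB.instance Definition _ := Topological.on weak_star.

Definition weak_star_closure (M : set dual) : set dual :=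
  closure (M : set weak_star).

End Dual.

Section Geometry.
Variables (R : realType) (X : normedModType R).

Definition support_functionals (x : X) : set (dual X) :=
  [set f | dual_norm f = 1 /\ f x = `|x|].

Definition smooth_point (x : X) : Prop :=
  x != 0 /\ exists f, support_functionals x = [set f].

Definition supporting_at_smooth (Y : {pred X}) : set (dual X) :=
  [set f | dual_norm f = 1 /\
    exists y : X, [/\ smooth_point y, y \in Y, `|y| = 1 & f y = 1]].

Definition best_coapproximation (Y : {pred X}) (x y0 : X) : Prop :=
  y0 \in Y /\ forall y, y \in Y -> `|y0 - y| <= `|x - y|.

Definition anti_coproximinal (Y : {pred X}) : Prop :=
  forall x, x \notin Y -> ~ exists y0, best_coapproximation Y x y0.

End Geometry.

Definition smooth_space (R : realType) (X : normedModType R) : Prop :=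
  forall x : X, `|x| = 1 -> smooth_point x.

(* Main.v *)
Require Import Defs.
From mathcomp Require Import all_boot all_order all_algebra.
From mathcomp Require Import all_classical all_reals all_analysis.
From mathcomp Require Import lra.
Import Order.TTheory GRing.Theory Num.Theory.
Import numFieldNormedType.Exports.
Local Open Scope classical_set_scope.
Local Open Scope ring_scope.

Set Implicit Arguments.
Unset Strict Implicit.
Unset Printing Implicit Defensive.

(** Both conditions say that only [z = 0] is annihilated by J_Y.
    If [y0] is a best coapproximation to [x], then [z = x - y0] satisfies
    [|y| <= |y + s z|] for all [y] in [Y] and all scalars [s]; by Hahn-Banach
    each unit vector [y] of [Y] has a support functional vanishing at [z], and
    by smoothness it is the only one, so J_Y annihilates [z].  Conversely, if
    J_Y annihilates [z <> 0], then [z] is not in [Y] and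
    [|y| = f y = f (y - z) <= |y - z|] for the support functional [f] of [y],
    so [0] is a best coapproximation to [z].
    On the other side, a functional lies in the weak* closure of span J_Y iff
    it vanishes at every [z] annihilated by J_Y. *)

(** * Sublinear functionals and a Hahn-Banach theorem with lower bounds *)

Section Sublinear.
Context {R : realType} {V : lmodType R}.

Definition sublinear (p : V -> R) : Prop :=
  (forall x y, p (x + y) <= p x + p y) /\
  (forall c x, 0 <= c -> p (c *: x) <= c * p x).

Definition convex_cone (C : V -> R -> Prop) : Prop :=
  [/\ C 0 0,
      forall v a w b, C v a -> C w b -> C (v + w) (a + b) &
      forall c v a, 0 <= c -> C v a -> C (c *: v) (c * a)].

(* The largest sublinear [q] such that [q <= p] and [q (- v) <= - a] whenever
   [C v a]: passing from [p] to it imposes [a <= f v] on every linear [f <= q]. *)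
Definition cone_inf (p : V -> R) (C : V -> R -> Prop) (x : V) : R :=
  inf [set r | exists v a, C v a /\ r = p (x + v) - a].

Lemma sublinear0 (p : V -> R) : sublinear p -> p 0 = 0.
Proof.
move=> [pD pZ]; apply/eqP; rewrite eq_le.
have := pD 0 0; have := pZ 0 0 (lexx _); rewrite scale0r mul0r addr0 => -> /=.
by move=> ?; lra.
Qed.

Section ConeInf.
Variables (p : V -> R) (C : V -> R -> Prop).
Hypotheses (sub_p : sublinear p) (cone_C : convex_cone C).
Hypothesis C_le : forall v a, C v a -> a <= p v.

Lemma cone_inf_le x v a : C v a -> cone_inf p C x <= p (x + v) - a.
Proof.
move=> Cva; apply: ge_inf; last by exists v, a.
(* [C_le] and subadditivity give [b <= p w <= p (x + w) + p (- x)]. *)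
exists (- p (- x)) => _ [w [b [Cwb ->]]].
have := C_le Cwb; have := sub_p.1 (x + w) (- x); rewrite addrC addKr.
by move=> ? ?; lra.
Qed.

Lemma le_cone_inf x r :
  (forall v a, C v a -> r <= p (x + v) - a) -> r <= cone_inf p C x.
Proof.
move=> lb; apply: lb_le_inf; last by move=> _ [v [a [Cva ->]]]; exact: lb.
by exists (p (x + 0) - 0), 0, 0; split=> //; case: cone_C.
Qed.

Lemma cone_inf_le_sublinear x : cone_inf p C x <= p x.
Proof.
by have [C0 _ _] := cone_C; have := cone_inf_le x C0; rewrite addr0 subr0.
Qed.

Lemma cone_inf_sublinear : sublinear (cone_inf p C).
Proof.
have [C0 CD CZ] := cone_C; have [pD pZ] := sub_p; split=> [x y|c x c_ge0].
- rewrite -lerBlDr; apply: le_cone_inf => v a Cva.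
  rewrite lerBlDr -lerBlDl; apply: le_cone_inf => w b Cwb.
  have := cone_inf_le (x + y) (CD _ _ _ _ Cva Cwb); rewrite addrACA.
  by have := pD (x + v) (y + w); move=> ? ?; lra.
- have [->|c_neq0] := eqVneq c 0.
    rewrite scale0r mul0r; have := cone_inf_le_sublinear 0.
    by rewrite (sublinear0 sub_p).
  have c_gt0 : 0 < c by rewrite lt0r c_neq0.
  rewrite mulrC -ler_pdivrMr //; apply: le_cone_inf => v a Cva.
  rewrite ler_pdivrMr //.
  have := cone_inf_le (c *: x) (CZ _ _ _ c_ge0 Cva); rewrite -scalerDr.
  by have := pZ c (x + v) c_ge0; move=> ? ?; nra.
Qed.

End ConeInf.

Lemma minimal_sublinear_scalar (q : V -> R^o) : sublinear q ->
  (forall q', sublinear q' -> (forall x, q' x <= q x) -> q' = q) -> scalar q.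
Proof.
move=> sub_q min_q; have [qD qZ] := sub_q.
have qA x y : q (x + y) = q x + q y.
  apply/eqP; rewrite eq_le qD /=.
  (* Minimality applied to [cone_inf] over the ray through [(y, q y)] yields
     [q x <= q (x + y) - q y]. *)
  pose C v a := exists t, 0 <= t /\ v = t *: y /\ a = t * q y.
  have cone_C : convex_cone C.
    split; first by exists 0; rewrite scale0r mul0r.
      move=> _ _ _ _ [t [t0 [-> ->]]] [u [u0 [-> ->]]]; exists (t + u).
      by rewrite scalerDl mulrDl addr_ge0.
    move=> c _ _ c0 [t [t0 [-> ->]]]; exists (c * t).
    by rewrite scalerA mulrA mulr_ge0.
  have C_le v a : C v a -> a <= q v.
    move=> [t [t0 [-> ->]]]; have [->|t_neq0] := eqVneq t 0.
      by rewrite scale0r mul0r (sublinear0 sub_q).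
    (* Homogeneity is assumed only as [<=]; the reverse comes from rescaling [t *: y] by [t^-1]. *)
    have t_gt0 : 0 < t by rewrite lt0r t_neq0.
    rewrite mulrC -ler_pdivlMr // mulrC.
    have := qZ t^-1 (t *: y); rewrite invr_ge0 => /(_ t0).
    by rewrite scalerA mulVf // scale1r.
  have qE := min_q _ (cone_inf_sublinear sub_q cone_C C_le)
    (cone_inf_le_sublinear sub_q cone_C C_le).
  have Cy : C y (q y) by exists 1; rewrite scale1r mul1r.
  by have := cone_inf_le sub_q C_le x Cy; rewrite qE; move=> ?; lra.
have q0 := sublinear0 sub_q.
have qN x : q (- x) = - q x.
  by apply/eqP; rewrite -addr_eq0 -qA addNr q0.
(* Since [q] is odd, [qZ] at [- x] is the reverse inequality. *)
have qZge0 c x : 0 <= c -> q (c *: x) = c * q x.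
  move=> c0; apply/eqP; rewrite eq_le qZ //=.
  by have := qZ c (- x) c0; rewrite scalerN !qN mulrN lerN2.
move=> c x y; rewrite qA; congr (_ + _).
have [/qZge0 -> //|c_lt0] := leP 0 c.
by rewrite -[c in LHS]opprK scaleNr qN qZge0 ?mulNr ?opprK // oppr_ge0 ltW.
Qed.

(** Zorn's lemma for the reversed pointwise order, so that maximal means minimal; a nonempty chain
    is bounded by its pointwise infimum. *)
Lemma exists_minimal_sublinear (p : V -> R) : sublinear p ->
  exists q, [/\ sublinear q, forall x, q x <= p x &
    forall q', sublinear q' -> (forall x, q' x <= q x) -> q' = q].
Proof.
move=> sub_p; pose T := {q : V -> R | sublinear q /\ forall x, q x <= p x}.
pose le (s t : T) := `[< forall x, sval t x <= sval s x >].
have [| | | |[q [sub_q q_le]] max_q] := @Zorn T le.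
- by move=> t; apply/asboolP.
- move=> r s t /asboolP rs /asboolP st; apply/asboolP => x.
  exact: le_trans (st x) (rs x).
- move=> [s ?] [t ?] /asboolP st /asboolP ts; apply/eq_exist/funext => x /=.
  by apply/le_anti; rewrite st ts.
- move=> A totA; have [[t0 At0]|A0] := pselect (A !=set0); last first.
    exists (exist _ p (conj sub_p (fun x => lexx (p x)))) => s As.
    by case: A0; exists s.
  pose E x := [set sval t x | t in A].
  have E_lb x : has_lbound (E x).
    exists (- p (- x)) => _ [[t /= [sub_t t_le]] At <-].
    have := sub_t.1 x (- x); rewrite subrr (sublinear0 sub_t).
    by have := t_le (- x); move=> ? ?; lra.
  have inf_le t x : A t -> inf (E x) <= sval t x.
    by move=> At; apply: ge_inf => //; exists t.
  have le_infE x r : (forall t, A t -> r <= sval t x) -> r <= inf (E x).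
    move=> lb; apply: lb_le_inf; first by exists (sval t0 x), t0.
    by move=> _ [t At <-]; exact: lb.
  have inf_sub : sublinear (fun x => inf (E x)).
    split=> [x y|c x c0].
      rewrite -lerBlDr; apply: (le_infE _ _) => s As.
      rewrite lerBlDr -lerBlDl; apply: (le_infE _ _) => t At; rewrite lerBlDl.
      (* The lower of the two comparable members bounds the infimum at [x + y] by
         [sval s x + sval t y]. *)
      have [/asboolP st|/asboolP ts] := totA _ _ As At.
        apply: le_trans (inf_le t _ At) _; have := (svalP t).1.1 x y.
        by have := st x; move=> ? ?; lra.
      apply: le_trans (inf_le s _ As) _; have := (svalP s).1.1 x y.
      by have := ts y; move=> ? ?; lra.
    have [->|c_neq0] := eqVneq c 0.
      rewrite scale0r mul0r; apply: le_trans (inf_le t0 _ At0) _.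
      by rewrite (sublinear0 (svalP t0).1).
    have c_gt0 : 0 < c by rewrite lt0r c_neq0.
    rewrite mulrC -ler_pdivrMr //; apply: (le_infE _ _) => t At.
    rewrite ler_pdivrMr // mulrC; apply: le_trans (inf_le t _ At) _.
    exact: (svalP t).1.2.
  have inf_le_p x : inf (E x) <= p x.
    exact: le_trans (inf_le t0 _ At0) ((svalP t0).2 x).
  exists (exist _ (fun x => inf (E x)) (conj inf_sub inf_le_p)) => s As.
  by apply/asboolP => x /=; exact: inf_le.
- exists q; split=> // q' sub_q' q'_le.
  have q'_le_p x : q' x <= p x by apply: le_trans (q_le x).
  have := max_q (exist _ q' (conj sub_q' q'_le_p)).
  by move=> /(_ (introT (asboolP _) q'_le)) [].
Qed.

(** A minimal sublinear [f] below [cone_inf p C] is linear, and [f (- v) <= p (- v + v) - a = - a]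
    whenever [C v a]. *)
Lemma Mazur_Orlicz (p : V -> R) (C : V -> R -> Prop) :
  sublinear p -> convex_cone C -> (forall v a, C v a -> a <= p v) ->
  exists f : V -> R^o,
    [/\ scalar f, forall x, f x <= p x & forall v a, C v a -> a <= f v].
Proof.
move=> sub_p cone_C C_le.
have [f [sub_f f_le min_f]] :=
  exists_minimal_sublinear (cone_inf_sublinear sub_p cone_C C_le).
have lin_f := @minimal_sublinear_scalar f sub_f min_f.
exists f; split=> // [x|v a Cva].
  exact: le_trans (f_le x) (cone_inf_le_sublinear sub_p cone_C C_le x).
have fN : f (- v) = - f v.
  by have := lin_f (- 1) v 0; rewrite (sublinear0 sub_f) !addr0 scaleN1r mulN1r.
have := cone_inf_le sub_p C_le (- v) Cva; rewrite addNr (sublinear0 sub_p).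
by have := f_le (- v); rewrite fN; move=> ? ?; lra.
Qed.

End Sublinear.

(** * Elements of the dual and their norm *)

Section DualFacts.
Context {R : realType} {X : normedModType R}.
Implicit Types (f g : dual X) (x y z : X).

Lemma dual_scalar f : scalar f.
Proof. by case: f => f /= /asboolP[]. Qed.

Lemma dualB f x y : f (x - y) = f x - f y.
Proof.
by rewrite [x - y]addrC -scaleN1r dual_scalar mulN1r addrC.
Qed.

Lemma dual_at0 f : f 0 = 0.
Proof. by rewrite -(subrr 0) dualB subrr. Qed.

Lemma dualN f x : f (- x) = - f x.
Proof. by rewrite -sub0r dualB dual_at0 sub0r. Qed.

Lemma dualZ f c x : f (c *: x) = c * f x.
Proof. by have := dual_scalar f c x 0; rewrite dual_at0 !addr0. Qed.

Lemma dual_addE f g x : (f + g) x = f x + g x.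
Proof. by []. Qed.

Lemma dual_scaleE c f x : (c *: f) x = c * f x.
Proof. by []. Qed.

Lemma dual_le_norm f x : dual_norm f = 1 -> f x <= `|x|.
Proof.
move=> f1; have [->|x_neq0] := eqVneq x 0; first by rewrite dual_at0 normr0.
have x_gt0 : 0 < `|x| by rewrite normr_gt0.
(* Without a genuine supremum [sup] would be 0, which norm 1 excludes. *)
have [/sup_upper_bound ub|/sup_out] :=
  pselect (has_sup [set `|f x| | x in [set x : X | `|x| <= 1]]); last first.
  by move: f1 => /[swap]; rewrite /dual_norm => -> /eqP; rewrite eq_sym oner_eq0.
have : `|f (`|x|^-1 *: x)| <= dual_norm f.
  apply: ub; exists (`|x|^-1 *: x) => //=.
  by rewrite normrZ normfV normr_id mulVf // gt_eqF.
rewrite f1 => /(le_trans (ler_norm _)).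
by rewrite dualZ mulrC ler_pdivrMr // mul1r.
Qed.

(** The one-sided bound at [x] and [- x] gives [|f x| <= |x|], hence continuity and norm at most 1;
    the value at [y] attains it. *)
Lemma dual_of_le_norm (f : X -> R^o) y : scalar f ->
  (forall x, f x <= `|x|) -> `|y| = 1 -> f y = 1 ->
  exists2 g : dual X, support_functionals y g & g = f :> (X -> R^o).
Proof.
move=> lin_f f_le y1 fy1.
have fB x z : f (x - z) = f x - f z.
  by rewrite [x - z]addrC -scaleN1r lin_f mulN1r addrC.
have f_abs x : `|f x| <= `|x|.
  rewrite ler_norml f_le andbT lerNl.
  have f0 : f 0 = 0 by rewrite -(subrr 0) fB subrr.
  by have := f_le (- x); rewrite normrN -[- x]sub0r fB f0 sub0r.
have cont_f : continuous f.
  move=> x; apply/cvgrPdist_lt => e e_gt0; near=> z.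
  rewrite -fB; apply: le_lt_trans (f_abs _) _.
  by near: z; apply: cvgr_dist_lt.
have f_dual : f \in @dual_pred R X by apply/asboolP.
exists (Dual f_dual) => //; split; last by rewrite y1.
apply/eqP; rewrite eq_le; apply/andP; split.
  apply: ge_sup; first by exists `|f 0|, 0; rewrite //= normr0.
  by move=> _ [x /= x1 <-]; exact: le_trans (f_abs x) x1.
apply: ub_le_sup; last by exists y => /=; rewrite ?y1 // fy1 normr1.
by exists 1 => _ [x /= x1 <-]; exact: le_trans (f_abs x) x1.
Unshelve. all: by end_near. Qed.

(** * Spans in the dual and their weak* closure *)

Lemma lin_span_sub (W : set (dual X)) : W `<=` lin_span W.
Proof.
by move=> f Wf; exists 1, (fun=> 1), (fun=> f); rewrite big_ord1 scale1r.
Qed.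

Lemma lin_span0 (W : set (dual X)) : lin_span W 0.
Proof.
by exists 0, (fun=> 0), (fun=> 0); split; [case|rewrite big_ord0].
Qed.

Lemma lin_span_linear (W : set (dual X)) c f g :
  lin_span W f -> lin_span W g -> lin_span W (c *: f + g).
Proof.
move=> [n [a [v [Wv ->]]]] [m [b [w [Ww ->]]]].
exists (n + m),
  (fun i => match fintype.split i with inl j => c * a j | inr j => b j end),
  (fun i => match fintype.split i with inl j => v j | inr j => w j end).
split; first by move=> i; case: fintype.split.
rewrite big_split_ord /= scaler_sumr; congr (_ + _); apply: eq_bigr => i _.
  by rewrite (unsplitK (inl i)) scalerA.
by rewrite (unsplitK (inr i)).
Qed.

Lemma lin_span_annihilates (W : set (dual X)) z f :
  (forall g, W g -> g z = 0) -> lin_span W f -> f z = 0.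
Proof.
move=> Wz [n [a [w [Ww ->]]]].
rewrite (big_morph (fun g : dual X => g z) (fun f g => dual_addE f g z)
  (erefl : (0 : dual X) z = 0)).
by rewrite big1 // => i _; rewrite dual_scaleE Wz // mulr0.
Qed.

Lemma interpolation (s : seq X) (L : set (dual X)) (h : dual X) : L 0 ->
  (forall c f g, L f -> L g -> L (c *: f + g)) ->
  (forall z, (forall f, L f -> f z = 0) -> h z = 0) ->
  exists2 f, L f & forall x, x \in s -> f x = h x.
Proof.
elim: s L h => [|x s IH] L h L0 Llin Lh; first by exists 0.
(* Induct on [s], replacing [L] by its subspace of functionals vanishing at [x]
   and [h] by its projection along some [g] in [L] with [g x = 1]. *)
have [[g Lg gx]|Lx] := pselect (exists2 g, L g & g x = 1); last first.
  (* By rescaling, all of [L] vanishes at [x]; then so does [h], and [x] imposes no constraint. *)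
  have {}Lx f : L f -> f x = 0.
    move=> Lf; apply/eqP/negPn/negP => fx; apply: Lx; exists ((f x)^-1 *: f).
      by rewrite -[_ *: _]addr0; exact: Llin.
    by rewrite dual_scaleE mulVf.
  have [f Lf fs] := IH L h L0 Llin Lh; exists f => // y.
  by rewrite inE => /predU1P[->|/fs //]; rewrite Lx // Lh.
have [||z L'z|f [Lf fx] fs] := IH [set f | L f /\ f x = 0] (- h x *: g + h).
- by split.
- move=> c f f' [Lf fx] [Lf' f'x]; split; first exact: Llin.
  by rewrite dual_addE dual_scaleE fx f'x mulr0 addr0.
(* For [f] in [L], [f - f x *: g] lies in the smaller subspace and so vanishes at [z]; hence [f]
   vanishes at [z - g z *: x]. *)
- have : h (z - g z *: x) = 0.
    apply: Lh => f Lf; have : (- f x *: g + f) z = 0.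
      apply: L'z; split; first exact: Llin.
      by rewrite dual_addE dual_scaleE gx mulr1 addNr.
    by rewrite dual_addE dual_scaleE dualB dualZ mulNr addrC mulrC.
  by rewrite dual_addE dual_scaleE dualB dualZ mulNr addrC mulrC.
exists (h x *: g + f); first exact: Llin.
move=> y; rewrite inE dual_addE dual_scaleE => /predU1P[->|/fs ->].
  by rewrite gx fx mulr1 addr0.
by rewrite dual_addE dual_scaleE mulNr addNKr.
Qed.

Lemma weak_star_evaluation_continuous x :
  continuous (fun f : weak_star X => (f : dual X) x).
Proof.
move=> f.
have c1 := @initial_continuous (dual X) {ptws X -> R^o} (@dual_fun R X) f.
exact: (cvg_comp _ _ c1 (@proj_continuous X (fun=> R^o) x (dual_fun f))).
Qed.

(** Vanishing at [z] is a weak* closed condition. Conversely, by interpolation the span matches [h]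
    on every finite set, which is all that a weak* neighbourhood of [h] can test. *)
Lemma weak_star_closure_span (W : set (dual X)) (h : dual X) :
  weak_star_closure (lin_span W) h <->
  forall z, (forall f, W f -> f z = 0) -> h z = 0.
Proof.
split=> [Wh z Wz|Wh].
  have cl : closed ((fun f : weak_star X => (f : dual X) z) @^-1` [set 0]).
    apply: closed_comp; last exact: closed_eq.
    by move=> f _; exact: weak_star_evaluation_continuous.
  apply: (cl h); apply: closure_subset Wh => f.
  exact: lin_span_annihilates.
move=> A [_ [[B openB <-]] Bh BA].
pose agree (s : seq X) :=
  [set f | lin_span W f /\ forall x, x \in s -> f x = h x].
have agree_neq0 s : agree s !=set0.
  have [||z Wz|f Lf fs] := interpolation s (L := lin_span W) (h := h).
  - exact: lin_span0.
  - by move=> c f g; exact: lin_span_linear.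
  - by apply: Wh => f Wf; apply: Wz; exact: lin_span_sub.
  - by exists f.
(* Along this filter, values at each point are eventually those of [h], so it converges to [h]
   pointwise. *)
pose F : set_system (X -> R^o) :=
  filter_from setT (fun s => @dual_fun R X @` agree s).
have FF : Filter F.
  apply: filter_from_filter; first by exists [::].
  move=> s t _ _; exists (s ++ t) => // _ [f [Lf fst] <-]; split; exists f => //.
    by split=> // x xs; apply: fst; rewrite mem_cat xs.
  by split=> // x xt; apply: fst; rewrite mem_cat xt orbT.
have Fh : {ptws, F --> (h : X -> R^o)}.
  apply/pointwise_cvgP => x; apply: cvg_near_cst.
  exists [:: x] => // _ [f [Lf fx] <-]; apply: fx; exact: mem_head.
have [s _ sB] : F B by apply: Fh; exact: open_nbhs_nbhs.
have [f [Lf fs]] := agree_neq0 s; exists f; split=> //.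
by apply: BA; apply: sB; exists f.
Qed.

End DualFacts.

(** * Best coapproximations and the annihilator of the support functionals *)

Section Coapproximation.
Context {R : realType} {X : normedModType R} {Y : submodClosed X}.

(** This is Birkhoff-James orthogonality of [Y] to [x - y0]: test the coapproximation at
    [y0 - s^-1 *: y] and multiply by [|s|]. *)
Lemma best_coapproximation_orthogonal x y0 : best_coapproximation Y x y0 ->
  forall y s, y \in Y -> `|y| <= `|y + s *: (x - y0)|.
Proof.
move=> [Yy0 best] y s Yy; have [->|s_neq0] := eqVneq s 0.
  by rewrite scale0r addr0.
have := best (y0 - s^-1 *: y); rewrite -scaleNr rpredD ?rpredZ // scaleNr.
move=> /(_ isT).
rewrite subKr opprB [x + _]addrC -addrA [- y0 + _]addrC => le_s.
have -> : y + s *: (x - y0) = s *: (s^-1 *: y + (x - y0)).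
  by rewrite [RHS]scalerDr scalerA mulfV // scale1r.
rewrite -[y in leLHS](scale1r y) -(mulfV s_neq0) -scalerA !normrZ.
by apply: ler_wpM2l => //; rewrite -normrZ.
Qed.

Lemma orthogonal_annihilates z :
  (forall y s, y \in Y -> `|y| <= `|y + s *: z|) ->
  forall f, supporting_at_smooth Y f -> f z = 0.
Proof.
move=> orth f [f1 [y [[_ [f0 Jy]] Yy y1 fy]]].
(* The functional [a *: y + s *: z |-> a] on the span of [y] and [z], kept as a relation so that
   independence need not be checked; orthogonality bounds it by the norm. *)
pose C (v : X) (a : R) := exists s, v = a *: y + s *: z.
have [||v a [s ->]|g [lin_g g_le g_ge]] :=
  @Mazur_Orlicz R X (fun x => `|x|) C.
- split=> [x x'|c x c0]; first exact: ler_normD.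
  by rewrite normrZ ger0_norm.
- split; first by exists 0; rewrite !scale0r addr0.
    move=> _ a _ b [s ->] [t ->]; exists (s + t).
    by rewrite !scalerDl addrACA.
  by move=> c _ a c0 [s ->]; exists (c * s); rewrite scalerDr !scalerA.
- apply: le_trans (orth _ s (rpredZ a Yy)).
  by rewrite normrZ y1 mulr1 ler_norm.
have gy : g y = 1.
  apply/eqP; rewrite eq_le -{1}y1 g_le /=; apply: g_ge.
  by exists 0; rewrite scale1r scale0r addr0.
have [g' Jg gE] := dual_of_le_norm lin_g g_le y1 gy.
have -> : f = g'.
  have Jf : support_functionals y f by split=> //; rewrite y1.
  by move: Jf Jg; rewrite Jy => -> ->.
(* The pairs [(s *: z, 0)] lie in [C] for both signs of [s], which forces the value 0 at [z]. *)
have ge0 s : 0 <= g' (s *: z).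
  by rewrite gE; apply: g_ge; exists s; rewrite scale0r add0r.
apply/eqP; rewrite eq_le; have := ge0 1; have := ge0 (- 1).
by rewrite scaleN1r scale1r dualN oppr_ge0 => -> ->.
Qed.

(** Smoothness makes the set of support functionals at [u] a singleton, hence nonempty: this
    supplies a norming functional for [z]. *)
Lemma smooth_support (smoothX : smooth_space X) (z : X) : z != 0 ->
  let u := `|z|^-1 *: z in
  [/\ smooth_point u, `|u| = 1 &
      exists f : dual X, [/\ dual_norm f = 1, f u = 1 & f z = `|z|]].
Proof.
move=> z_neq0 u; have nz : `|z| != 0 by rewrite normr_eq0.
have u1 : `|u| = 1 by rewrite normrZ normfV normr_id mulVf.
have su := smoothX _ u1; split=> //; have [_ [f Ju]] := su.
have [f1 fu] : support_functionals u f by rewrite Ju.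
exists f; split=> //; first by rewrite fu.
have -> : z = `|z| *: u by rewrite scalerA mulfV // scale1r.
by rewrite dualZ fu u1 mulr1 normrZ normr_id u1 mulr1.
Qed.

Lemma anti_coproximinal_annihilator (smoothX : smooth_space X) :
  anti_coproximinal Y <->
  forall z, (forall f, supporting_at_smooth Y f -> f z = 0) -> z = 0.
Proof.
split=> [anti z Wz|ann x xNY [y0 best]].
  apply/eqP/negPn/negP => z_neq0.
  have Wy y : y \in Y -> y != 0 ->
      exists f, [/\ supporting_at_smooth Y f, dual_norm f = 1 & f y = `|y|].
    move=> Yy y_neq0.
    have [su u1 [f [f1 fu fy]]] := smooth_support smoothX y_neq0.
    exists f; split=> //; split=> //; exists (`|y|^-1 *: y).
    by split=> //; exact: rpredZ.
  apply: (anti z).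
    apply/negP => Yz; have [f [Wf _ fz]] := Wy z Yz z_neq0.
    by move/eqP: fz; rewrite Wz // eq_sym normr_eq0 (negbTE z_neq0).
  exists 0; split; first exact: rpred0.
  move=> y Yy; rewrite sub0r normrN distrC.
  have [->|y_neq0] := eqVneq y 0; first by rewrite normr0.
  have [f [Wf f1 <-]] := Wy y Yy y_neq0.
  by rewrite -[f y]subr0 -(Wz f Wf) -dualB; exact: dual_le_norm.
have /eqP := ann _ (orthogonal_annihilates (best_coapproximation_orthogonal best)).
rewrite subr_eq0 => /eqP xE; move: xNY; rewrite xE => /negP; apply.
by case: best.
Qed.

End Coapproximation.

Theorem theorem2p6 (R : realType) (X : completeNormedModType R)
    (Y : submodClosed X) (smoothX : smooth_space X)
    (properY : exists x : X, x \notin Y) (dimY : dim_gt 1 Y) :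
  anti_coproximinal Y <->
  weak_star_closure (lin_span (supporting_at_smooth Y)) = [set: dual X].
Proof.
apply: iff_trans (anti_coproximinal_annihilator smoothX) _; split=> [ann|clT z Wz].
  apply/seteqP; split=> // h _; apply/weak_star_closure_span => z /ann ->.
  exact: dual_at0.
apply/eqP/negPn/negP => z_neq0.
(* A functional norming [z] lies in the closure, so it would have to vanish at [z]. *)
have [_ _ [f [_ _ fz]]] := smooth_support smoothX z_neq0.
have /weak_star_closure_span/(_ z Wz) :
  weak_star_closure (lin_span (supporting_at_smooth Y)) f by rewrite clT.
by move/eqP; rewrite fz normr_eq0 (negbTE z_neq0).
Qed.
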